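(* Let $X,Y$ be separable Banach spaces and $p,q\in[1,+\infty)$. The following are equivalent: (1) $X$ finitely H\''older$(\frac pq)$ embeds into $\ell_q(Y)$; (2) for every sequence $(F_n)_{n\in\mathbb N}$ of finite subsets of $X$, $E((F_n)_{n\in\mathbb N},p)\le_B E(Y,q)$.
   Context: $\ell_q(Y)$ is the Banach space of $x\in Y^{\mathbb N}$ with $\|x\|_{Y,q}=(\sum_n\|x(n)\|_Y^q)^{1/q}<\infty$. Each $F_n$ is a (nonempty) finite metric space with the metric induced by $\|\cdot\|_X$, and $E((F_n)_n,p)$ is the equivalence relation on $\prod_nF_n$ given by $(x,y)\in E\iff\sum_n\|x(n)-y(n)\|_X^p<+\infty$. $E(Y,q)$ is the relation on $Y^{\mathbb N}$ with $(x,y)\in E(Y,q)\iff\sum_n\|x(n)-y(n)\|_Y^q<+\infty$. $E\le_B F$ means there is a Borel map $\theta$ with $(x,y)\in E\iff(\theta(x),\theta(y))\in F$. $M$ finitely H\''older$(\alpha)$ embeds into $M'$ if there is $A>0$ such that for every finite $F\subseteq M$ there is $T_F:F\to M'$ with $\frac1Ad(u,v)^\alpha\le d'(T_F(u),T_F(v))\le Ad(u,v)^\alpha$ for $u,v\in F$. *)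

(* Defs.v *)
From HB Require Import structures.
From mathcomp Require Import all_boot all_order all_algebra.
From mathcomp Require Import all_classical all_reals all_analysis.

Set Implicit Arguments.
Unset Strict Implicit.
Unset Printing Implicit Defensive.

Import Order.TTheory GRing.Theory Num.Theory.
Import numFieldNormedType.Exports.

Local Open Scope classical_set_scope.
Local Open Scope ring_scope.

Definition separable_space (T : topologicalType) : Prop :=
  exists2 D : set T, countable D & dense D.

Definition Borel_set (T : topologicalType) : set (set T) := <<s @open T >>.

Definition Borel_map (S T : topologicalType) (theta : S -> T) : Prop :=
  forall B : set T, Borel_set B -> Borel_set (theta @^-1` B).

Definition Borel_reducible (S T : topologicalType)
    (E : S -> S -> Prop) (F : T -> T -> Prop) : Prop :=
  exists theta : S -> T,
    Borel_map theta /\ forall x y : S, E x y <-> F (theta x) (theta y).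

(* [d] and [d'] are the distances of the metric spaces [M] and [M']. *)
Definition finitely_Holder_embeds (R : realType) (alpha : R)
    (M : Type) (d : M -> M -> R) (M' : Type) (d' : M' -> M' -> R) : Prop :=
  exists2 A : R, 0 < A &
    forall F : set M, finite_set F ->
      exists T : F -> M', forall u v : F,
        A^-1 * d (\val u) (\val v) `^ alpha <= d' (T u) (T v)
          <= A * d (\val u) (\val v) `^ alpha.

Section sequence_spaces.
Context {R : realType}.

Definition norm_dist (V : normedModType R) (u v : V) : R := `|u - v|.

Definition sum_norm_pow (V : normedModType R) (q : R) (x : nat -> V) : \bar R :=
  (\sum_(0 <= n <oo) (`|x n| `^ q)%:E)%E.

Definition ell (V : normedModType R) (q : R) : set (nat -> V) :=
  [set x | (sum_norm_pow q x < +oo)%E].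

Arguments ell : clear implicits.

Definition ell_norm (V : normedModType R) (q : R) (x : nat -> V) : R :=
  fine (sum_norm_pow q x) `^ q^-1.

Definition ell_dist (V : normedModType R) (q : R) (x y : ell V q) : R :=
  ell_norm q (fun n => (\val x) n - (\val y) n).

(* [ell_norm] uses [fine], so it is the l_q norm only on [ell V q]; [ell_dist]
   never leaves that set. *)
Lemma ellB (V : normedModType R) (q : R) (x y : nat -> V) :
  1 <= q -> ell V q x -> ell V q y -> ell V q (fun n => x n - y n).
Proof.
rewrite /ell /sum_norm_pow /= => q1 ex ey.
have q0 : 0 <= q by exact: le_trans ler01 q1.
have pge0 (z : nat -> V) n : (0 <= (`|z n| `^ q)%:E)%E by rewrite lee_fin powR_ge0.
apply: (@le_lt_trans _ _ (\sum_(0 <= n <oo)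
   ((2 `^ q)%:E * ((`|x n| `^ q)%:E + (`|y n| `^ q)%:E)))%E).
  apply: lee_nneseries => [n _ _|n _]; first by rewrite lee_fin powR_ge0.
  rewrite -EFinD -EFinM lee_fin.
  have le2 : `|x n - y n| <= 2 * Num.max `|x n| `|y n|.
    rewrite (le_trans (ler_normB _ _))// mulr_natl mulr2n lerD// le_max lexx//.
    by rewrite orbT.
  apply: (le_trans (ge0_ler_powR q0 _ _ le2)); rewrite ?nnegrE ?mulr_ge0 ?le_max ?normr_ge0//.
  rewrite powRM ?le_max ?normr_ge0// ler_pM2l ?powR_gt0//.
  by rewrite maxEle; case: ifP => _; rewrite ?lerDl ?lerDr powR_ge0.
rewrite nneseriesZl//; last first.
  by move=> n _; rewrite adde_ge0 ?pge0.
rewrite nneseriesD; [|by move=> *; exact: pge0..].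
by rewrite lte_mul_pinfty ?lte_add_pinfty// lee_fin powR_ge0.
Qed.

(* The n-th factor [F n] carries the subspace topology, which for a finite [F n]
   is the discrete one. *)
Definition E_fin (X : normedModType R) (F : nat -> set X) (p : R)
    (x y : prod_topology (fun n => set_type (F n))) : Prop :=
  (\sum_(0 <= n <oo) (norm_dist (\val (x n)) (\val (y n)) `^ p)%:E < +oo)%E.

Definition E_seq (Y : normedModType R) (q : R)
    (x y : prod_topology (fun _ : nat => Y)) : Prop :=
  (\sum_(0 <= n <oo) (norm_dist (x n) (y n) `^ q)%:E < +oo)%E.

End sequence_spaces.
Arguments E_fin {R X} F p x y.
Arguments E_seq {R} Y q x y.

(* Main.v *)
(** A Hoelder embedding of each [F n] into l_q(Y) yields a continuous reduction
    by concatenation, since d'^q is comparable with d^p.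

    Conversely, let [e] enumerate a dense subset of X and let
    F n = {e 0, ..., e n}.  A Borel reduction theta of E((F n), p) to E(Y, q) is
    continuous on a comeager set invariant under finite changes.  Baire category
    then provides coordinates l 0 < l 1 < ..., a filling of all the other
    coordinates, and consecutive blocks of N such that, up to a summable error,
    the i-th block of theta x depends on x (l i) only.  This gives maps T i with
    sum_i d(u i, v i)^p < oo iff sum_i d'(T i (u i), T i (v i))^q < oo whenever
    u i and v i are in F (l i).  If d'(T i u, T i v)^q / d(u, v)^p were not
    eventually bounded above and below, uniformly over close pairs (u, v) of
    terms of [e], repeating bad pairs suitably often would make exactly one of
    the two sums finite.  Finally, the Hoelder condition is invariant under
    scaling, so that any finite subset of X can be shrunk and then approximated
    by terms of [e]. *)

Require Import Defs.
From HB Require Import structures.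
From mathcomp Require Import all_boot all_order all_algebra.
From mathcomp Require Import all_classical all_reals all_analysis.
From mathcomp Require Import ring lra.

Set Implicit Arguments.
Unset Strict Implicit.
Unset Printing Implicit Defensive.

Import Order.TTheory GRing.Theory Num.Theory.
Import numFieldNormedType.Exports.

Local Open Scope classical_set_scope.
Local Open Scope ring_scope.

(** * Category in products of finite sets *)

Section increasing_nat.
Context {l : nat -> nat} (lS : forall i, (l i < l i.+1)%N).

Lemma incr_ltn : {homo l : i j / (i < j)%N}.
Proof. exact: homo_ltn ltn_trans lS. Qed.

Lemma incr_leq : {homo l : i j / (i <= j)%N}.
Proof. exact: ltnW_homo incr_ltn. Qed.

Lemma incr_inj : injective l.
Proof.
by move=> i j lij; case: (ltngtP i j) => // /incr_ltn; rewrite lij ltnn.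
Qed.

Lemma incr_ge_id i : (i <= l i)%N.
Proof. by elim: i => // i /leq_ltn_trans; apply. Qed.

Lemma incr_gap i n : (l i < n < l i.+1)%N -> ~ exists j, l j = n.
Proof.
move=> lnl [j jn]; move: lnl; rewrite -{}jn => /andP[lij lji].
have [/incr_leq ji|/incr_leq ij] := leqP j i.
  by have := leq_trans lij ji; rewrite ltnn.
by have := leq_trans lji ij; rewrite ltnn.
Qed.

End increasing_nat.

Definition agree {T : nat -> Type} (m : nat) (x y : forall n, T n) : Prop :=
  forall i, (i < m)%N -> x i = y i.

Definition splice {T : nat -> Type} (l : nat) (s x : forall n, T n) :
  forall n, T n := fun i => if (i < l)%N then s i else x i.

Definition tail_eq {T : nat -> Type} (l : nat) (x y : forall n, T n) : Prop :=
  forall i, (l <= i)%N -> x i = y i.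

Definition finite_factors (T : nat -> Type) : Prop :=
  forall n, exists r (t : nat -> T n), forall u, exists2 j, (j < r)%N & u = t j.

(* [O] has dense interior for the product of the discrete topologies; the basic
   open sets are the [agree m' z']. *)
Definition dense_int {T : nat -> Type} (O : set (forall n, T n)) : Prop :=
  forall z m, exists z' m', [/\ (m <= m')%N, agree m z z' &
    forall y, agree m' z' y -> O y].

Section sequences.
Context {T : nat -> Type}.
Local Notation Z := (forall n, T n).
Implicit Types (x y z s : Z) (O G B : set Z) (P : nat -> set Z) (l m : nat).

Lemma agree_sym m x y : agree m x y -> agree m y x.
Proof. by move=> xy i im; rewrite xy. Qed.

Lemma agree_trans m y x z : agree m x y -> agree m y z -> agree m x z.
Proof. by move=> xy yz i im; rewrite xy// yz. Qed.

Lemma agree_le m m' x y : (m <= m')%N -> agree m' x y -> agree m x y.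
Proof. by move=> mm' xy i im; apply/xy/(leq_trans im). Qed.

Lemma tail_eq_sym l x y : tail_eq l x y -> tail_eq l y x.
Proof. by move=> xy i im; rewrite xy. Qed.

Lemma tail_eq_trans l y x z : tail_eq l x y -> tail_eq l y z -> tail_eq l x z.
Proof. by move=> xy yz i im; rewrite xy// yz. Qed.

Lemma tail_eq_splice l s x : tail_eq l (splice l s x) x.
Proof. by move=> i li; rewrite /splice ltnNge li. Qed.

Lemma agree_splice l s x : agree l (splice l s x) s.
Proof. by move=> i li; rewrite /splice li. Qed.

Lemma splice_tail_eq l x y : tail_eq l x y -> splice l y x = y.
Proof.
move=> xy; apply: functional_extensionality_dep => i; rewrite /splice.
by case: ltnP => // /xy.
Qed.

Lemma eq_splice l s s' x : agree l s s' -> splice l s x = splice l s' x.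
Proof.
move=> ss'; apply: functional_extensionality_dep => i; rewrite /splice.
by case: ltnP => // /ss'.
Qed.

Lemma finite_prefixes (x0 : Z) : finite_factors T ->
  forall l, exists r (s : nat -> Z),
  forall y, exists2 j, (j < r)%N & agree l y (s j).
Proof.
move=> fT; elim=> [|l [r [s hs]]].
  by exists 1%N, (fun=> x0) => y; exists 0%N.
have [r' [t ht]] := fT l.
exists (r * r')%N, (fun j => dfwith (s (j %/ r')%N) l (t (j %% r')%N)) => y.
have [j jr yj] := hs y; have [k kr yk] := ht (y l).
have r'0 : (0 < r')%N by exact: leq_ltn_trans kr.
exists (j * r' + k)%N.
  rewrite (@leq_trans (j.+1 * r'))//; first by rewrite mulSn addnC ltn_add2r.
  by rewrite leq_mul2r jr orbT.
rewrite divnMDl// divn_small// addn0 modnMDl modn_small// => i.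
rewrite ltnS leq_eqVlt => /predU1P[->|il]; first by rewrite dfwithin yk.
by rewrite dfwithout ?yj// gtn_eqF.
Qed.

Lemma agree_limit (l : nat -> nat) (z : nat -> Z) :
  (forall i, (l i < l i.+1)%N) -> (forall i, agree (l i) (z i) (z i.+1)) ->
  exists c : Z, forall i, agree (l i) (z i) c.
Proof.
move=> lS zS.
have zz i j n : (i <= j)%N -> (n < l i)%N -> z j n = z i n.
  move=> /subnKC <- nl; elim: (j - i)%N => [|d ih]; first by rewrite addn0.
  rewrite addnS -ih -zS//.
  by rewrite (leq_trans nl)// (incr_leq lS)// leq_addr.
exists (fun n => z n.+1 n) => i n nl.
have [ni|/ltnW ni] := leqP n.+1 i; last by rewrite (zz i).
by rewrite (zz n.+1)// incr_ge_id.
Qed.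

Lemma baire P : (forall k, dense_int (P k)) ->
  forall z m, exists2 x, agree m z x & forall k, P k x.
Proof.
move=> dP z m.
pose R k (a b : Z * nat) := [/\ (a.2 < b.2)%N, agree a.2 a.1 b.1 &
  forall y, agree b.2 b.1 y -> P k y].
have step k a : {b | R k a b}.
  apply: cid; have [z' [m' [am ag h]]] := dP k a.1 a.2.
  exists (z', m'.+1); split => // y /(agree_le (leqnSn _)); exact: h.
pose f := fix f k := if k is k'.+1 then sval (step k' (f k')) else (z, m).
have fS k : R k (f k) (f k.+1) by rewrite /=; case: (step k (f k)).
have [||x xf] := @agree_limit (fun k => (f k).2) (fun k => (f k).1);
  [by move=> k; case: (fS k)..|].
exists x; first exact: (xf 0%N).
by move=> k; have [_ _] := fS k; apply; exact: xf.
Qed.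

Lemma dense_int_splice (x0 : Z) O l : finite_factors T -> dense_int O ->
  dense_int [set x | forall s, O (splice l s x)].
Proof.
move=> fT dO z m; have [r [s hs]] := finite_prefixes x0 fT l.
suff [z' [m' [mm' zz' h]]] : exists z' m', [/\ (maxn m l <= m')%N,
    agree m z z' & forall y, agree m' z' y ->
      forall j, (j < r)%N -> O (splice l (s j) y)].
  exists z', m'; split => //.
    by rewrite (leq_trans _ mm')// leq_maxl.
  move=> y /h {}h s'; have [j jr s'j] := hs s'.
  by rewrite (eq_splice _ s'j); exact: h.
elim: r {hs} => [|r [z' [m' [mm' zz' h]]]].
  by exists z, (maxn m l); split.
have lm' : (l <= m')%N by rewrite (leq_trans _ mm')// leq_maxr.
have [z'' [m'' [m'm'' zz'' h'']]] := dO (splice l (s r) z') m'.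
have ag : agree m' (splice l z' z'') z'.
  move=> i im'; rewrite /splice; case: ltnP => // li.
  by rewrite -zz''// /splice ltnNge li.
exists (splice l z' z''), m''; split; first exact: leq_trans m'm''.
  apply: (agree_trans zz'); apply/agree_sym/(agree_le _ ag).
  by rewrite (leq_trans _ mm')// leq_maxl.
move=> y yz j; rewrite ltnS leq_eqVlt => /predU1P[->|jr]; last first.
  by apply: h => //; apply/(agree_trans (agree_sym ag))/(agree_le m'm'').
apply: h'' => i im''; rewrite /splice; case: ltnP => li.
  rewrite -zz''; first by rewrite agree_splice.
  exact: leq_trans lm'.
by rewrite -yz// /splice ltnNge li.
Qed.

Definition locally_constant_on G B : Prop :=
  forall x, G x -> exists m, forall y, G y -> agree m x y -> (B x <-> B y).

Definition generic P : set Z := [set x | forall k, P k x].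

(* Equivalent to the Baire property; countable unions are then handled without
   enumerating the basic open sets. *)
Definition decided B : Prop := exists2 P, (forall k, dense_int (P k)) &
  locally_constant_on (generic P) B.

Lemma locally_constant_onS G G' B : G' `<=` G ->
  locally_constant_on G B -> locally_constant_on G' B.
Proof.
move=> GG' cB x /GG' Gx; have [m h] := cB x Gx.
by exists m => y /GG'; exact: h.
Qed.

Lemma countably_decided (B : nat -> set Z) : (forall n, decided (B n)) ->
  exists2 P, (forall k, dense_int (P k)) &
    forall n, locally_constant_on (generic P) (B n).
Proof.
move=> /(_ _)/cid2 dB.
pose Q n := s2val (dB n).
pose P k : set Z := if unpickle k is Some (n, i) then Q n i else setT.
exists P => [k|n].
  rewrite /P; case: (unpickle k) => [[n i]|]; last by move=> z m; exists z, m.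
  exact: (s2valP (dB n) i).
apply: locally_constant_onS (s2valP' (dB n)) => x Px i.
by have := Px (pickle (n, i)); rewrite /P pickleK.
Qed.

Lemma decided_bigcup (B : nat -> set Z) : (forall n, decided (B n)) ->
  decided (\bigcup_n B n).
Proof.
move=> /countably_decided[P dP cB].
pose U := \bigcup_n B n.
pose W := [set x | exists m, (forall y, agree m x y -> generic P y -> U y) \/
  (forall y, agree m x y -> generic P y -> ~ U y)].
exists (fun k => if k is k'.+1 then P k' else W).
  case=> [|k]; last exact: dP.
  move=> z m.
  have [[x [zx Gx [n _ Bx]]]|no] :=
    pselect (exists x, [/\ agree m z x, generic P x & U x]).
    have [m' h] := cB n x Gx.
    exists x, (maxn m m'); split; rewrite ?leq_maxl// => y xy.
    exists (maxn m m'); left => y' yy' Gy'; exists n => //; apply/(h y') => //.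
    by apply: (agree_le (leq_maxr m m')); exact: agree_trans yy'.
  exists z, m; split => // y zy; exists m; right => y' yy' Gy' Uy'.
  by apply: no; exists y'; split => //; exact: agree_trans yy'.
move=> x Gx; have [m h] := Gx 0%N.
exists m => y Gy xy.
have Gx' : generic P x by move=> k; exact: (Gx k.+1).
have Gy' : generic P y by move=> k; exact: (Gy k.+1).
case: h => h; split => ?; first exact: h.
- by apply: h.
- by exfalso; apply: (h x).
- by exfalso; apply: (h y).
Qed.

End sequences.

Lemma nbhs_prod_agree (K : nat -> topologicalType) (U : set (prod_topology K))
    (x : prod_topology K) :
  nbhs x U -> exists m, forall y : prod_topology K, agree m x y -> U y.
Proof.
pose F : set_system (prod_topology K) :=
  [set A | exists m, forall y : prod_topology K, agree m x y -> A y].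
have FF : Filter F.
  split; first by exists 0%N.
    move=> A B [m hA] [m' hB]; exists (maxn m m') => y xy; split.
      by apply/hA/(agree_le (leq_maxl _ _) xy).
    by apply/hB/(agree_le (leq_maxr _ _) xy).
  by move=> A B AB [m hA]; exists m => y /hA/AB.
suff : F --> x by exact.
apply/cvg_sup => i A [_ [[W oW <-]/= Wx sA]].
by exists i.+1 => y xy; apply: sA => /=; rewrite -xy.
Qed.

Lemma decided_Borel (K : nat -> topologicalType) (B : set (prod_topology K)) :
  Borel_set B -> decided B.
Proof.
move=> /(_ [set B | decided B]); apply; split; first split.
- exists (fun=> setT) => [k z m|x _]; first by exists z, m.
  by exists 0%N.
- move=> A [P dP cA]; exists P => // x Gx; have [m h] := cA x Gx.
  by exists m => y Gy xy; have := h y Gy xy; rewrite /setD/=; tauto.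
- exact: decided_bigcup.
move=> U; rewrite openE => oU.
pose W := [set x : prod_topology K | exists m,
  (forall y : prod_topology K, agree m x y -> U y) \/
  (forall y : prod_topology K, agree m x y -> ~ U y)].
exists (fun=> W) => [_ z m|x /(_ 0%N)[m h]]; last first.
  exists m => y _ xy; case: h => h; split => ?; first exact: h.
  - exact: h.
  - by exfalso; apply: (h x).
  - by exfalso; apply: (h y).
have [[x [zx Ux]]|no] := pselect (exists x : prod_topology K, agree m z x /\ U x).
  have [m' h] := nbhs_prod_agree (oU x Ux).
  exists x, (maxn m m'); split; rewrite ?leq_maxl// => y xy.
  exists (maxn m m'); left => y' yy'; apply: h.
  by apply: (agree_le (leq_maxr m m')); exact: agree_trans yy'.
exists z, m; split => // y zy; exists m; right => y' yy' Uy'.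
by apply: no; exists y'; split => //; exact: agree_trans yy'.
Qed.

Lemma Borel_map_generic_continuous (R : realType) (Y : normedModType R)
    (K : nat -> topologicalType)
    (theta : prod_topology K -> prod_topology (fun _ : nat => Y)) :
  separable_space Y -> Borel_map theta ->
  exists2 P : nat -> set (prod_topology K), (forall k, dense_int (P k)) &
    forall x n eps, generic P x -> 0 < eps -> exists m, forall y, generic P y ->
      agree m x y -> `|theta x n - theta y n| < eps.
Proof.
move=> [D /countable_injP[/= f injf] dD] bt.
pose d (j : nat) : set Y := [set y | D y /\ f y = j].
pose B (k : nat) : set (prod_topology K) :=
  if unpickle k is Some (n, j, i) then
    [set x | exists2 y, d j y & `|theta x n - y| < i.+1%:R^-1] else setT.
have dB k : decided (B k).
  rewrite /B; case: (unpickle k) => [[[n j] i]|]; last first.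
    by exists (fun=> setT) => [? z m|x _]; [exists z, m|exists 0%N].
  apply: decided_Borel.
  pose V := [set v : prod_topology (fun _ : nat => Y) |
    exists2 y, d j y & `|v n - y| < i.+1%:R^-1].
  rewrite (_ : [set x | _] = theta @^-1` V)//.
  apply: bt; apply: sub_sigma_algebra.
  rewrite openE => v [y dy vy].
  have nb : nbhs (v n) (ball y (i.+1%:R^-1 : R)).
    apply: open_nbhs_nbhs; split; first exact: ball_open.
    by rewrite -ball_normE/= distrC.
  have nb' : nbhs v (@proj nat (fun=> Y) n @^-1` ball y (i.+1%:R^-1 : R)).
    exact: (@proj_continuous nat (fun=> Y) n v _ nb).
  move: nb'; apply: filterS => w; rewrite /proj/=.
  by rewrite -ball_normE /= distrC => wy; exists y.
have [P dP cP] := countably_decided dB.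
exists P => // x n eps Gx e0.
have [i ie] : exists i : nat, i.+1%:R^-1 < eps / 2.
  have := near_infty_natSinv_lt (PosNum (divr_gt0 e0 (@ltr0n R 2 : 0 < 2))).
  by move=> [N _ /(_ N (leqnn N))] /=; exists N.
have [y [xy Dy]] : (ball (theta x n) (i.+1%:R^-1 : R) `&` D) !=set0.
  apply: dD; last exact: ball_open.
  by exists (theta x n); exact: ballxx.
have [m h] := cP (pickle (n, f y, i)) x Gx.
exists m => z Gz xz; have := h z Gz xz; rewrite /B pickleK.
move=> [BB _]; have [|z' [Dz' fz'] zy] := BB.
  by exists y => //; move: xy; rewrite -ball_normE.
rewrite (_ : z' = y) in zy; last by apply: injf; rewrite ?inE.
move: xy; rewrite -ball_normE/= => xy.
rewrite (le_lt_trans (ler_distD y _ _))// (@lt_le_trans _ _ (eps/2 + eps/2))//.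
  by rewrite ltrD ?(lt_trans xy)// distrC (lt_trans zy).
by rewrite -splitr.
Qed.

(** * Stabilizing a Borel reduction on blocks *)

Section real_sums.
Context {R : realType}.
Implicit Types (f g : nat -> R) (K : nat -> nat).

Definition bounded_sums f : Prop :=
  exists M, forall n, \sum_(0 <= i < n) f i <= M.

Lemma nneseries_lt_pinftyP f : (forall n, 0 <= f n) ->
  (\sum_(0 <= n <oo) (f n)%:E < +oo)%E <-> bounded_sums f.
Proof.
move=> f0; split => [foo|[M fM]].
  have s0 : (0 <= \sum_(0 <= n <oo) (f n)%:E)%E.
    by apply: nneseries_ge0 => n _ _; rewrite lee_fin.
  have sfin : (\sum_(0 <= n <oo) (f n)%:E)%E \is a fin_num.
    by rewrite ge0_fin_numE.
  exists (fine (\sum_(0 <= n <oo) (f n)%:E)%E) => n.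
  rewrite -lee_fin fineK// -sumEFin.
  by apply: nneseries_lim_ge => k _; rewrite lee_fin.
apply: (@le_lt_trans _ _ M%:E); last exact: ltry.
apply: lime_le.
  by apply: is_cvg_nneseries => n _ _; rewrite lee_fin.
by apply: nearW => n; rewrite sumEFin lee_fin.
Qed.

Lemma le_bounded_sums f g : (forall n, f n <= g n) ->
  bounded_sums g -> bounded_sums f.
Proof. by move=> fg [M gM]; exists M => n; exact: le_trans (ler_sum _ _) (gM n). Qed.

Lemma bounded_sumsD f g :
  bounded_sums f -> bounded_sums g -> bounded_sums (fun n => f n + g n).
Proof.
by move=> [M fM] [N gN]; exists (M + N) => n; rewrite big_split lerD.
Qed.

Lemma bounded_sumsZ c f : 0 <= c ->
  bounded_sums f -> bounded_sums (fun n => c * f n).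
Proof.
by move=> c0 [M fM]; exists (c * M) => n; rewrite -mulr_sumr ler_wpM2l.
Qed.

Lemma sum_geometric_half n : \sum_(0 <= i < n) (2^-1 : R) ^+ i = 2 - 2 * 2^-1 ^+ n.
Proof.
elim: n => [|n ih]; first by rewrite big_geq// expr0 mulr1 subrr.
by rewrite big_nat_recr//= ih exprS; field.
Qed.

Lemma bounded_sums_geometric_half : bounded_sums (fun i => 2^-1 ^+ i).
Proof.
by exists 2 => n; rewrite sum_geometric_half gerBl mulr_ge0// exprn_ge0.
Qed.

Lemma le_sum_nat f k m n N : (forall n, 0 <= f n) -> (k <= m)%N -> (n <= N)%N ->
  \sum_(m <= i < n) f i <= \sum_(k <= i < N) f i.
Proof.
move=> f0 km nN; have [mn|/ltnW nm] := leqP m n; last first.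
  by rewrite big_geq// sumr_ge0.
rewrite (big_cat_nat km (leq_trans mn nN))/= (big_cat_nat mn nN)/=.
by rewrite addrCA lerDl addr_ge0// sumr_ge0.
Qed.

Lemma bounded_sums_tail f e : (forall n, 0 <= f n) -> bounded_sums f -> 0 < e ->
  exists k, forall N, \sum_(k <= n < N) f n <= e.
Proof.
move=> f0 [M fM] e0.
pose A := [set \sum_(0 <= i < n) f i | n in [set: nat]].
have supA : has_sup A.
  split; first by exists (\sum_(0 <= i < 0) f i); exists 0%N.
  by exists M => _ [n _ <-].
have [_ [k _ <-] hk] := sup_adherent e0 supA.
exists k => N; have [kN|/ltnW Nk] := leqP k N; last by rewrite big_geq// ltW.
have : \sum_(0 <= i < N) f i <= sup A.
  by apply: (ub_le_sup supA.2); exists N.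
rewrite (big_cat_nat (leq0n k) kN)/= => h.
by rewrite -(lerD2l (\sum_(0 <= i < k) f i)) (le_trans h)// -lerBlDr ltW.
Qed.

Lemma sum_blocks f K m : K 0%N = 0%N -> (forall i, (K i < K i.+1)%N) ->
  \sum_(0 <= n < K m) f n =
  \sum_(0 <= i < m) \sum_(K i <= n < K i.+1) f n.
Proof.
move=> K0 Kmon; elim: m => [|m ih]; first by rewrite K0 !big_geq.
by rewrite big_nat_recr//= -ih -big_cat_nat//= ltnW.
Qed.

Lemma bounded_sums_blocks f K : (forall n, 0 <= f n) ->
  K 0%N = 0%N -> (forall i, (K i < K i.+1)%N) ->
  bounded_sums f <-> bounded_sums (fun i => \sum_(K i <= n < K i.+1) f n).
Proof.
move=> f0 K0 Kmon; split => -[M fM]; exists M => n.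
  by rewrite -sum_blocks.
by rewrite (le_trans _ (fM n))// -sum_blocks// le_sum_nat// incr_ge_id.
Qed.

Lemma powR_leD (q a b c : R) : 0 <= q -> 0 <= a -> 0 <= b -> 0 <= c -> a <= b + c ->
  a `^ q <= 2 `^ q * (b `^ q + c `^ q).
Proof.
move=> q0 a0 b0 c0 abc.
have m0 : 0 <= Num.max b c by rewrite le_max b0.
have le2 : a <= 2 * Num.max b c.
  by rewrite (le_trans abc)// mulr_natl mulr2n lerD// le_max lexx ?orbT.
apply: (le_trans (ge0_ler_powR q0 _ _ le2)); rewrite ?nnegrE ?mulr_ge0//.
rewrite powRM// ler_pM2l ?powR_gt0//.
by rewrite maxEle; case: ifP => _; rewrite ?lerDl ?lerDr powR_ge0.
Qed.

Lemma powR_invK (q a : R) : q != 0 -> 0 <= a -> (a `^ q^-1) `^ q = a.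
Proof. by move=> q0 a0; rewrite -powRrM mulVf// powRr1. Qed.

Lemma powRK_inv (q a : R) : q != 0 -> 0 <= a -> (a `^ q) `^ q^-1 = a.
Proof. by move=> q0 a0; rewrite -powRrM mulfV// powRr1. Qed.

Lemma exists_small_powR (q e : R) (N : nat) : 0 < q -> 0 < e ->
  exists2 d, 0 < d & N%:R * (d + d) `^ q <= e.
Proof.
move=> q0 e0; have eN : 0 < e / N.+1%:R by rewrite divr_gt0.
exists ((e / N.+1%:R) `^ q^-1 / 2); first by rewrite divr_gt0// powR_gt0.
rewrite -splitr (powR_invK _ (ltW eN)) ?gt_eqF// mulrA ler_pdivrMr// mulrC.
by rewrite ler_wpM2l ?ler_nat// ltW.
Qed.

End real_sums.

Section one_step.
Context {R : realType} {Y : normedModType R} {T : nat -> Type}.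
Local Notation Z := (forall n, T n).
Variables (x0 : Z) (q : R) (theta : Z -> nat -> Y) (P : nat -> set Z).
Hypothesis fT : finite_factors T.
Hypothesis q1 : 1 <= q.
Hypothesis dP : forall k, dense_int (P k).
Local Notation G := (generic P).
Hypothesis contG : forall x n eps, G x -> 0 < eps ->
  exists m, forall y, G y -> agree m x y -> `|theta x n - theta y n| < eps.
Hypothesis tailG : forall l x y, tail_eq l x y -> G x -> G y.
Local Notation D x y := (fun n => `|theta x n - theta y n| `^ q).
Hypothesis tail_bounded : forall l x y, tail_eq l x y -> bounded_sums (D x y).

Let q0 : 0 < q. Proof. exact: lt_le_trans ltr01 q1. Qed.

Lemma generic_continuous x N eps : G x -> 0 < eps ->
  exists m, forall y, G y -> agree m x y ->
    forall n, (n < N)%N -> `|theta x n - theta y n| < eps.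
Proof.
move=> Gx e0; elim: N => [|N [m hm]]; first by exists 0%N.
have [m' hm'] := contG N Gx e0.
exists (maxn m m') => y Gy xy n; rewrite ltnS leq_eqVlt => /predU1P[->|].
  by apply: hm' => //; exact: (agree_le (leq_maxr _ _) xy).
by apply: hm => //; exact: (agree_le (leq_maxl _ _) xy).
Qed.

Definition small_tail l eps K : set Z :=
  [set x | forall y y', tail_eq l x y -> tail_eq l x y' ->
    forall N, \sum_(K <= n < N) D y y' n <= eps].

Lemma uniform_tail l eps x : 0 < eps -> exists K, small_tail l eps K x.
Proof.
move=> e0; have [r [s hs]] := finite_prefixes x0 fT l.
have h j k : exists K, forall N,
    \sum_(K <= n < N) D (splice l (s j) x) (splice l (s k) x) n <= eps.
  apply: bounded_sums_tail => //.
  apply: (@tail_bounded l); apply: (@tail_eq_trans _ _ x).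
    exact: tail_eq_splice.
  exact/tail_eq_sym/tail_eq_splice.
pose K j k := sval (cid (h j k)).
exists (\max_(j < r) \max_(k < r) K j k) => y y' xy xy' N.
have [j jr yj] := hs y; have [k kr yk] := hs y'.
rewrite -(splice_tail_eq xy) -(splice_tail_eq xy').
rewrite (eq_splice _ yj) (eq_splice _ yk).
apply: le_trans (svalP (cid (h j k)) N); apply: le_sum_nat => //.
apply: (@leq_trans (\max_(k < r) K j k)).
  exact: (leq_bigmax (F := fun k : 'I_r => K j k) (Ordinal kr)).
exact: (leq_bigmax (F := fun j : 'I_r => \max_(k < r) K j k) (Ordinal jr)).
Qed.

(* The loss of a constant factor replaces the continuity of [powR]. *)
Lemma open_large_tail l eps K x : 0 < eps -> G x -> ~ small_tail l eps K x ->
  exists m, forall y, G y -> agree m x y -> ~ small_tail l (eps / (2 * 2 `^ q)) K y.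
Proof.
move=> e0 Gx nS; set eps' := eps / _.
have e'0 : 0 < eps' by rewrite divr_gt0// mulr_gt0// powR_gt0.
have [y [y' [xy [xy' [N hN]]]]] : exists y y', tail_eq l x y /\ (tail_eq l x y' /\
    exists N, eps < \sum_(K <= n < N) D y y' n).
  apply: contrapT => no; apply: nS => y y' xy xy' N; rewrite leNgt; apply/negP => lt.
  by apply: no; exists y, y'; split => //; split => //; exists N.
have [d d0 dN] := exists_small_powR N q0 e'0.
have [m hm] := generic_continuous N (tailG xy Gx) d0.
have [m' hm'] := generic_continuous N (tailG xy' Gx) d0.
exists (maxn m m') => z Gz xz Sz.
pose w := splice l y z; pose w' := splice l y' z.
have yw : agree (maxn m m') y w.
  by move=> i im; rewrite /w /splice; case: ltnP => // li; rewrite -xy// xz.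
have y'w' : agree (maxn m m') y' w'.
  by move=> i im; rewrite /w' /splice; case: ltnP => // li; rewrite -xy'// xz.
have zw : tail_eq l z w by apply/tail_eq_sym/tail_eq_splice.
have zw' : tail_eq l z w' by apply/tail_eq_sym/tail_eq_splice.
have Gw := tailG zw Gz; have Gw' := tailG zw' Gz.
have {Sz} := Sz _ _ zw zw' N.
apply/negP; rewrite -ltNge -(ltr_pM2l (powR_gt0 q (ltr0n R 2))).
rewrite -(ltrD2r (2 `^ q * eps')).
have -> : 2 `^ q * eps' + 2 `^ q * eps' = eps.
  by rewrite /eps'; field; rewrite gt_eqF// powR_gt0.
apply: (lt_le_trans hN).
apply: (@le_trans _ _ (\sum_(K <= n < N) (2 `^ q * (D w w' n + (d + d) `^ q)))).
  rewrite big_nat_cond [leRHS]big_nat_cond.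
  apply: ler_sum => n /andP[/andP[_ nN] _].
  apply: (powR_leD (ltW q0) _ _ (ltW (addr_gt0 d0 d0))) => //.
  have h : `|theta y n - theta w n| < d.
    by apply: hm => //; exact: (agree_le (leq_maxl _ _) yw).
  have h' : `|theta y' n - theta w' n| < d.
    by apply: hm' => //; exact: (agree_le (leq_maxr _ _) y'w').
  rewrite (le_trans (ler_distD (theta w n) _ _))//.
  have := ler_distD (theta w' n) (theta w n) (theta y' n).
  rewrite [`|theta w' n - _|]distrC; lra.
rewrite -mulr_sumr -mulrDr ler_pM2l ?powR_gt0// big_split/= lerD2l.
rewrite sumr_const_nat -mulr_natl (le_trans _ dN)//.
by rewrite ler_wpM2r ?powR_ge0// ler_nat leq_subr.
Qed.

Lemma small_tailS l eps K K' : (K <= K')%N ->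
  small_tail l eps K `<=` small_tail l eps K'.
Proof.
move=> KK' x Sx y y' xy xy' N; apply: le_trans (Sx _ _ xy xy' N).
exact: le_sum_nat.
Qed.

Lemma tail_localization l eps z m : 0 < eps -> exists z' m' K,
  [/\ (m <= m')%N, agree m z z' &
   forall y, G y -> agree m' z' y -> small_tail l eps K y].
Proof.
move=> e0; apply: contrapT => no.
pose eps' := eps / (2 * 2 `^ q).
have e'0 : 0 < eps' by rewrite divr_gt0// mulr_gt0// powR_gt0.
pose W K := [set x | agree m z x -> exists m', forall y, G y -> agree m' x y ->
  ~ small_tail l eps' K y].
pose Q k := if odd k then W k./2 else P k./2.
have dQ k : dense_int (Q k).
  rewrite /Q; case: (odd k); last exact: dP.
  move=> z1 m1; have [zz1|zz1] := pselect (agree m z z1); last first.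
    exists z1, (maxn m m1); split; rewrite ?leq_maxr// => y zy zy'.
    exfalso; apply: zz1; apply: (agree_trans zy').
    exact/agree_sym/(agree_le _ zy)/leq_maxl.
  have [x [Gx z1x nS]] : exists x, [/\ G x, agree (maxn m m1) z1 x &
      ~ small_tail l eps k./2 x].
    apply: contrapT => no'; apply: no; exists z1, (maxn m m1), k./2.
    split; rewrite ?leq_maxl// => y Gy z1y; apply: contrapT => nS.
    by apply: no'; exists y.
  have [m' hm'] := open_large_tail e0 Gx nS.
  exists x, (maxn m1 m'); split; rewrite ?leq_maxl//.
    exact: (agree_le (leq_maxr _ _) z1x).
  move=> y xy _; exists m' => y' Gy' yy'; apply: hm' => //.
  by apply: agree_trans yy'; exact: (agree_le (leq_maxr _ _) xy).
have [x zx Qx] := baire dQ z m.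
have Gx : G x by move=> k; have := Qx k.*2; rewrite /Q odd_double doubleK.
have [K SK] := uniform_tail l x e'0.
have := Qx K.*2.+1; rewrite /Q /= odd_double/= uphalf_double.
by move=> /(_ zx)[m' /(_ x Gx)]; apply.
Qed.

Lemma stabilization_step i l K0 eps : 0 < eps -> exists c l' K,
  [/\ (l <= l')%N, (K0 < K)%N,
   forall y y', G y -> (forall n, (l <= n < l')%N -> y n = c n) ->
     tail_eq l y y' -> forall N, \sum_(K <= n < N) D y y' n <= eps,
   forall y y', G y -> G y' -> (forall n, (l <= n < l')%N -> y n = c n) ->
     agree l' y y' -> \sum_(0 <= n < K) D y y' n <= eps &
   forall y, (forall n, (l <= n < l')%N -> y n = c n) -> P i y].
Proof.
move=> e0.
have [z1 [m1 [K1 [lm1 _ hS]]]] := tail_localization l x0 l e0.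
have [z2 [m2 [m12 z12 hP]]] := dense_int_splice x0 l fT (dP i) z1 m1.
have [c z2c Gc] := baire dP z2 m2.
pose K := maxn K1 K0.+1.
have [d d0 dK] := exists_small_powR K q0 e0.
have [r [s hs]] := finite_prefixes x0 fT l.
have Gs j : G (splice l (s j) c).
  by apply: tailG Gc; exact/tail_eq_sym/tail_eq_splice.
pose M j := sval (cid (generic_continuous K (Gs j) d0)).
pose l' := maxn m2 (\max_(j < r) M j).
have m2l' : (m2 <= l')%N by rewrite leq_maxl.
have ll' : (l <= l')%N by rewrite (leq_trans lm1)// (leq_trans m12).
have stem m z y : (l <= m <= l')%N -> agree m z c ->
    (forall n, (l <= n < l')%N -> y n = c n) -> agree m z (splice l z y).
  move=> /andP[lm ml'] zc yc n nm; rewrite /splice; case: ltnP => // ln.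
  by rewrite yc ?zc// ln (leq_trans nm).
have z1c : agree m1 z1 c by exact: agree_trans z12 (agree_le m12 z2c).
exists c, l', K; split => //.
- by rewrite leq_maxr.
- move=> y y' Gy yc yy' N.
  have ty : tail_eq l (splice l z1 y) y by exact: tail_eq_splice.
  have := hS (splice l z1 y) (tailG (tail_eq_sym ty) Gy).
  move=> /(_ _)/(small_tailS (leq_maxl K1 K0.+1)); apply => //.
    by apply: stem => //; rewrite lm1 (leq_trans m12).
  exact: tail_eq_trans yy'.
- move=> y y' Gy Gy' yc yy'.
  have [j jr yj] := hs y.
  have sy : agree l' (splice l (s j) c) y.
    move=> n nl'; rewrite /splice; case: ltnP => [/yj->//|ln].
    by rewrite yc// ln.
  have Ml' : (M j <= l')%N.
    apply: (@leq_trans (\max_(j < r) M j)); last exact: leq_maxr.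
    exact: (leq_bigmax (F := fun j : 'I_r => M j) (Ordinal jr)).
  have hM := svalP (cid (generic_continuous K (Gs j) d0)).
  have h := hM y Gy (agree_le Ml' sy).
  have h' := hM y' Gy' (agree_le Ml' (agree_trans sy yy')).
  apply: le_trans dK; rewrite -[K in leRHS]subn0 mulr_natl -sumr_const_nat.
  rewrite big_nat_cond [leRHS]big_nat_cond.
  apply: ler_sum => n /andP[/andP[_ nK] _].
  apply: (ge0_ler_powR (ltW q0)); rewrite ?nnegrE ?(ltW (addr_gt0 d0 d0))//.
  rewrite ltW// (le_lt_trans (ler_distD (theta (splice l (s j) c) n) _ _))//.
  by rewrite ltrD ?h'// distrC h.
- move=> y yc; have := hP (splice l z2 y) _ y.
  have -> : splice l y (splice l z2 y) = y.
    apply: functional_extensionality_dep => n; rewrite /splice.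
    by case: ltnP.
  by apply; apply: stem => //; rewrite (leq_trans lm1).
Qed.

End one_step.

Lemma tail_invariant_generic (T : nat -> Type) (x0 : forall n, T n)
    (P : nat -> set (forall n, T n)) :
  finite_factors T -> (forall k, dense_int (P k)) ->
  exists P', [/\ forall k, dense_int (P' k), generic P' `<=` generic P &
    forall l x y, tail_eq l x y -> generic P' x -> generic P' y].
Proof.
move=> fT dP.
pose P' k := if unpickle k is Some (n, l) then
  [set x | forall s, P n (splice l s x)] else setT.
have GP' x : generic P' x <-> forall n l s, P n (splice l s x).
  split => [Gx n l s|h k]; first by have := Gx (pickle (n, l)); rewrite /P' pickleK.
  by rewrite /P'; case: unpickle => // -[n l].
exists P'; split.
- move=> k; rewrite /P'; case: unpickle => [[n l]|]; last by move=> z m; exists z, m.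
  exact: (dense_int_splice x0 l fT (dP n)).
- by move=> x /GP' Gx k; have := Gx k 0%N x; rewrite splice_tail_eq.
- move=> l x y xy /GP' Gx; apply/GP' => n l' s.
  rewrite -(@splice_tail_eq _ (maxn l l') x (splice l' s y))//.
  move=> i; rewrite geq_max => /andP[li l'i].
  by rewrite (tail_eq_splice s y l'i) xy.
Qed.

Section separated.
Context {R : realType} {Y : normedModType R}.
Implicit Types (a b c : nat -> Y).

Definition pdist (q : R) (k m : nat) a b := \sum_(k <= n < m) `|a n - b n| `^ q.

Lemma pdist_ge0 q k m a b : 0 <= pdist q k m a b.
Proof. by apply: sumr_ge0 => n _; exact: powR_ge0. Qed.

Lemma pdistC q k m a b : pdist q k m a b = pdist q k m b a.
Proof. by apply: eq_bigr => n _; rewrite distrC. Qed.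

Lemma pdist_triangle q k m b a c : 0 <= q ->
  pdist q k m a c <= 2 `^ q * (pdist q k m a b + pdist q k m b c).
Proof.
move=> q0; rewrite -big_split/= mulr_sumr; apply: ler_sum => n _.
by apply: powR_leD => //; exact: ler_distD.
Qed.

Context {T : nat -> Type}.
Local Notation Z := (forall n, T n).

Definition restrict_to (l : nat -> nat) (c w : Z) : Z :=
  fun n => if `[< exists i, l i = n >] then w n else c n.

Lemma separated_coordinates (x0 : Z) (q : R) (theta : Z -> nat -> Y)
    (P : nat -> set Z) : finite_factors T -> 1 <= q ->
  (forall k, dense_int (P k)) ->
  (forall x n eps, generic P x -> 0 < eps -> exists m, forall y,
     generic P y -> agree m x y -> `|theta x n - theta y n| < eps) ->
  (forall l x y, tail_eq l x y -> generic P x -> generic P y) ->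
  (forall l x y, tail_eq l x y ->
     bounded_sums (fun n => `|theta x n - theta y n| `^ q)) ->
  exists l K (c : Z), [/\ l 0%N = 0%N /\ (forall i, l i < l i.+1)%N,
    K 0%N = 0%N /\ (forall i, K i < K i.+1)%N &
    let psi i (u : T (l i)) :=
      theta (restrict_to l c (dfwith x0 (l i) u)) in
    forall w w' : Z,
      bounded_sums (fun n => `|theta (restrict_to l c w) n
                               - theta (restrict_to l c w') n| `^ q) <->
      bounded_sums (fun i => pdist q (K i) (K i.+1)
         (psi i (w (l i))) (psi i (w' (l i))))].
Proof.
move=> fT q1 dP contP tailP tailb.
have q0 : 0 <= q by exact: le_trans ler01 q1.
pose e i : R := 2^-1 ^+ i.
have e0 i : 0 < e i by rewrite exprn_gt0.
have step i l K := stabilization_step x0 fT q1 dP contP tailP tailb i l.+1 K (e0 i).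
pose R3 i (s t : nat * nat * Z) := [/\ (s.1.1 < t.1.1)%N, (s.1.2 < t.1.2)%N,
  agree s.1.1.+1 s.2 t.2 & let stem y :=
    forall n, (s.1.1 < n < t.1.1)%N -> y n = t.2 n in
  [/\ forall y y', generic P y -> stem y -> tail_eq s.1.1.+1 y y' ->
       forall N, pdist q t.1.2 N (theta y) (theta y') <= e i,
    forall y y', generic P y -> generic P y' -> stem y ->
       agree t.1.1 y y' -> pdist q 0 t.1.2 (theta y) (theta y') <= e i &
    forall y, stem y -> P i y]].
have {}step i s : {t | R3 i s t}.
  case: s => [[l K] z]; apply: cid.
  have [c [l' [K' [ll' KK' ha hb hc]]]] := step i l K.
  have ce n : (l < n < l')%N -> splice l.+1 z c n = c n.
    by move=> /andP[ln _]; rewrite /splice ltnNge ln.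
  exists (l', K', splice l.+1 z c); split => //=; first exact/agree_sym/agree_splice.
  split.
  - by move=> y y' Gy yc; apply: ha => // n nl; rewrite yc// ce.
  - by move=> y y' Gy Gy' yc; apply: hb => // n nl; rewrite yc// ce.
  - by move=> y yc; apply: hc => // n nl; rewrite yc// ce.
pose f := fix f k := if k is k'.+1 then sval (step k' (f k')) else (0%N, 0%N, x0).
have fS k : R3 k (f k) (f k.+1) by rewrite /=; case: (step k (f k)).
pose l i := (f i).1.1; pose K i := (f i).1.2; pose z i := (f i).2.
have lS i : (l i < l i.+1)%N by have [] := fS i.
have KS i : (K i < K i.+1)%N by have [] := fS i.
have l_le := incr_leq lS; have l_lt := incr_ltn lS.
have [//||c zc] := @agree_limit _ (fun i => (l i).+1) z.
  by move=> i; case: (fS i).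
have cz i n : (n <= l i)%N -> c n = z i n by move=> nl; rewrite zc.
pose x w := restrict_to l c w.
have stem i w n : (l i < n < l i.+1)%N -> x w n = (f i.+1).2 n.
  move=> h; rewrite /x /restrict_to; case: asboolP => [/(incr_gap lS h)//|_].
  by apply: cz; case/andP: h => _ /ltnW.
have Gx w : generic P (x w).
  by move=> i; have [_ _ _ [_ _]] := fS i; apply; exact: stem.
have xa i (w w' : Z) : (forall j, (i < j)%N -> w (l j) = w' (l j)) ->
    forall N, pdist q (K i.+1) N (theta (x w)) (theta (x w')) <= e i.
  move=> ww'; have [_ _ _ [h _ _]] := fS i; apply: h => //; first exact: stem.
  move=> n ln; rewrite /x /restrict_to; case: asboolP => // -[j jn].
  move: ln; rewrite -{}jn => lij; apply: ww'.
  by rewrite ltnNge; apply: contraTN lij => /l_le; rewrite -leqNgt.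
have xb i (w w' : Z) : (forall j, (j <= i)%N -> w (l j) = w' (l j)) ->
    pdist q 0 (K i.+1) (theta (x w)) (theta (x w')) <= e i.
  move=> ww'; have [_ _ _ [_ h _]] := fS i; apply: h => //; first exact: stem.
  move=> n ln; rewrite /x /restrict_to; case: asboolP => // -[j jn].
  move: ln; rewrite -{}jn => lij; apply: ww'.
  by rewrite leqNgt; apply: contraTN lij => /l_le; rewrite -leqNgt.
exists l, K, c; split; [by split..|] => psi w w'.
pose C : R := 2 `^ q.
have C0 : 0 <= C by exact: powR_ge0.
have err (v : Z) i :
    pdist q (K i) (K i.+1) (theta (x v)) (psi i (v (l i))) <= C * (3 * e i).
  pose v1 := splice (l i).+1 v x0.
  apply: (le_trans (pdist_triangle _ _ (theta (x v1)) _ _ q0)).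
  rewrite ler_wpM2l//.
  have -> : 3 * e i = e i + 2 * e i by ring.
  apply: lerD.
    apply: le_trans (xb i v v1 _); first exact: le_sum_nat.
    by move=> j /l_le ji; rewrite /v1 /splice ltnS ji.
  case: i => [|i] in v1 *.
    rewrite (_ : psi _ _ = theta (x v1)); last first.
      congr theta; apply: functional_extensionality_dep => n.
      rewrite /x /restrict_to; case: asboolP => // -[j <-].
      rewrite /v1 /splice; case: j => [|j]; first by rewrite dfwithin ltnS leqnn.
      by rewrite dfwithout ?ltn_eqF ?l_lt// ltnNge l_lt.
    rewrite /pdist big1 ?mulr_ge0 ?ltW//= => n _.
    by rewrite subrr normr0 powR0// gt_eqF// (lt_le_trans ltr01).
  have -> : 2 * e i.+1 = e i by rewrite /e exprS mulrA mulfV ?mul1r.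
  apply: xa => j ij; rewrite /v1 /splice.
  have [->|ij'] := eqVneq j i.+1; first by rewrite dfwithin ltnS leqnn.
  have lij : (l i.+1 < l j)%N by rewrite l_lt// ltn_neqAle eq_sym ij' ij.
  by rewrite dfwithout ?ltn_eqF// ltnNge lij.
have bound (a a' b b' : nat -> nat -> Y) :
    (forall i, pdist q (K i) (K i.+1) (a i) (b i) <= C * (3 * e i)) ->
    (forall i, pdist q (K i) (K i.+1) (a' i) (b' i) <= C * (3 * e i)) ->
    bounded_sums (fun i => pdist q (K i) (K i.+1) (b i) (b' i)) ->
    bounded_sums (fun i => pdist q (K i) (K i.+1) (a i) (a' i)).
  move=> ha ha' hb.
  apply: (@le_bounded_sums _ _ (fun i => C * (C * (3 * e i) +
     C * (pdist q (K i) (K i.+1) (b i) (b' i) + C * (3 * e i))))).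
    move=> i; apply: (le_trans (pdist_triangle _ _ (b i) _ _ q0)).
    rewrite ler_wpM2l// lerD//.
    apply: (le_trans (pdist_triangle _ _ (b' i) _ _ q0)).
    by rewrite ler_wpM2l// lerD2l pdistC.
  have geo : bounded_sums (fun i => C * (3 * e i)).
    by do 2![apply: bounded_sumsZ => //]; exact: bounded_sums_geometric_half.
  apply: bounded_sumsZ => //; apply: bounded_sumsD => //.
  by apply: bounded_sumsZ => //; apply: bounded_sumsD.
rewrite (bounded_sums_blocks _ _ KS)//; split.
  by apply: (bound _ _ (fun=> theta (x w)) (fun=> theta (x w'))) => i;
    rewrite pdistC.
by apply: (bound (fun=> theta (x w)) (fun=> theta (x w'))).
Qed.

End separated.

Lemma finite_factors_set_type (X : choiceType) (F : nat -> set X) :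
  (forall n, finite_set (F n) /\ F n !=set0) ->
  finite_factors (fun n => set_type (F n)).
Proof.
move=> hF n; have [/finite_seqP[s Fs] [x Fx]] := hF n.
pose x' : set_type (F n) := SigSub (mem_set Fx).
exists (size s), (fun j => insubd x' (nth x s j)) => u.
have FsP y : F n y -> y \in s by rewrite Fs.
have us : \val u \in s by apply: FsP; exact: set_valP.
exists (index (\val u) s); first by rewrite index_mem.
apply: val_inj; rewrite nth_index// insubdK//.
exact: valP u.
Qed.

Lemma separated_reduction (R : realType) (X Y : normedModType R) (p q : R)
    (F : nat -> set X) : 1 <= p -> 1 <= q -> separable_space Y ->
  (forall n, finite_set (F n) /\ F n !=set0) ->
  Borel_reducible (E_fin F p) (E_seq Y q) ->
  exists (l N : nat -> nat) (T : nat -> X -> nat -> Y),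
    [/\ forall i, (l i < l i.+1)%N,
        forall i u n, (N i <= n)%N -> T i u n = 0 &
        forall u v : nat -> X, (forall i, F (l i) (u i) /\ F (l i) (v i)) ->
          bounded_sums (fun i => `|u i - v i| `^ p) <->
          bounded_sums (fun i => pdist q 0 (N i) (T i (u i)) (T i (v i)))].
Proof.
move=> p1 q1 sY hF [theta [bt red]].
have p0 : p != 0 by rewrite gt_eqF// (lt_le_trans ltr01).
have q0 : q != 0 by rewrite gt_eqF// (lt_le_trans ltr01).
pose S n := set_type (F n).
have [w0 _] : exists w0 : forall n, S n, True.
  have h n : {x | F n x} by apply: cid; exact: (hF n).2.
  by exists (fun n => SigSub (mem_set (svalP (h n)))).
have fS : finite_factors S := finite_factors_set_type hF.
have redP (x y : forall n, S n) :
    bounded_sums (fun n => `|\val (x n) - \val (y n)| `^ p) <->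
    bounded_sums (fun n => `|theta x n - theta y n| `^ q).
  rewrite -!nneseries_lt_pinftyP; [|by move=> n; exact: powR_ge0..].
  exact: red.
have [P0 dP0 cP0] := Borel_map_generic_continuous sY bt.
have [P [dP PP0 tP]] := tail_invariant_generic w0 fS dP0.
have cP x n eps : generic P x -> 0 < eps -> exists m, forall y,
     generic P y -> agree m x y -> `|theta x n - theta y n| < eps.
  move=> /PP0 Gx e0; have [m hm] := cP0 x n eps Gx e0.
  by exists m => y /PP0; exact: hm.
have tb l x y : tail_eq l x y ->
     bounded_sums (fun n => `|theta x n - theta y n| `^ q).
  move=> xy; apply/redP; exists (\sum_(0 <= n < l) `|\val (x n) - \val (y n)| `^ p).
  move=> n; have [nl|/ltnW ln] := leqP n l; first exact: le_sum_nat.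
  rewrite (big_cat_nat (leq0n l) ln)/= gerDl big_nat_cond big1// => i.
  by rewrite andbT => /andP[li _]; rewrite xy// subrr normr0 powR0.
have [l [K [c [[l0 lS] [K0 KS] /= sep]]]] :=
  separated_coordinates w0 fS q1 dP cP tP tb.
pose psi i (u : X) n := theta (restrict_to l c (dfwith w0 (l i)
  (insubd (w0 (l i)) u))) n.
pose T i u n := if (K i <= n < K i.+1)%N then psi i u n else 0.
exists l, (fun i => K i.+1), T; split => //.
  by move=> i u n Kn; rewrite /T ltnNge Kn andbF.
move=> u v uvF.
pose lift (a : nat -> X) : forall n, S n := fun n =>
  if pselect (exists i, l i = n) is left h then insubd (w0 n) (a (sval (cid h)))
  else w0 n.
have liftE a i : lift a (l i) = insubd (w0 (l i)) (a i).
  rewrite /lift; case: pselect => [h|]; last by case; exists i.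
  by congr (insubd _ (a _)); apply: (incr_inj lS); case: (cid h).
have liftK a i : F (l i) (a i) -> \val (lift a (l i)) = a i.
  by move=> Fa; rewrite liftE insubdK//; exact: mem_set.
have lhs : bounded_sums (fun i => `|u i - v i| `^ p) <->
  bounded_sums (fun n => `|\val (restrict_to l c (lift u) n) -
                           \val (restrict_to l c (lift v) n)| `^ p).
  have g0 n : 0 <= `|\val (restrict_to l c (lift u) n) -
                     \val (restrict_to l c (lift v) n)| `^ p by exact: powR_ge0.
  apply: (iff_trans _ (iff_sym (bounded_sums_blocks g0 l0 lS))).
  rewrite (_ : (fun i => \sum_(_ <= n < _) _) = (fun i => `|u i - v i| `^ p))//.
  apply/funext => i; rewrite big_ltn// /restrict_to.
  case: asboolP => [_|]; last by case; exists i.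
  rewrite !liftK; [|by case: (uvF i)..].
  rewrite big_nat_cond big1 ?addr0// => n; rewrite andbT => /andP[ln nl].
  case: asboolP => [[j jn]|_]; last by rewrite subrr normr0 powR0.
  by exfalso; apply: (@incr_gap _ lS i n); [rewrite ln|exists j].
rewrite lhs redP sep.
rewrite (_ : (fun i => pdist q 0 (K i.+1) _ _) = (fun i => pdist q (K i) (K i.+1)
   (psi i (u i)) (psi i (v i)))); last first.
  apply/funext => i; rewrite /pdist (big_cat_nat (leq0n (K i)) (ltnW (KS i)))/=.
  rewrite big_nat_cond big1 ?add0r; last first.
    move=> n; rewrite andbT => /andP[_ nK].
    by rewrite /T leqNgt nK/= subrr normr0 powR0.
  by apply: eq_big_nat => n nK; rewrite /T nK.
by under eq_fun do rewrite !liftE.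
Qed.

(** * From reductions to Hoelder embeddings *)

Lemma eventually_in_seq (I : eqType) (s : seq I) (Q : I -> nat -> Prop) :
  (forall u, u \in s -> exists m, forall i, (m <= i)%N -> Q u i) ->
  exists m, forall i, (m <= i)%N -> forall u, u \in s -> Q u i.
Proof.
elim: s => [|a s ih] h; first by exists 0%N.
have [m hm] := h a (mem_head _ _).
have [m' hm'] : exists m, forall i, (m <= i)%N -> forall u, u \in s -> Q u i.
  by apply: ih => u us; apply: h; rewrite in_cons us orbT.
exists (maxn m m') => i; rewrite geq_max => /andP[mi m'i] u.
by rewrite in_cons => /predU1P[->|us]; [exact: hm|exact: hm'].
Qed.

Section condensation.
Context {R : realType} {Pi : Type} (pi0 : Pi).
Variables (f g : nat -> Pi -> R) (Q : nat -> Pi -> Prop).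
Hypothesis f_ge0 : forall i pi, 0 <= f i pi.
Hypothesis g_ge0 : forall i pi, 0 <= g i pi.
Hypothesis f_pi0 : forall i, f i pi0 = 0.
Hypothesis Q_pi0 : forall i, Q i pi0.

Lemma repeat_choice (pi : Pi) (r t : R) (m N : nat) :
  (forall m, exists i, [/\ (m <= i)%N, Q i pi, f i pi <= r & t <= g i pi]) ->
  exists m' (s : nat -> Pi), [/\ (m < m')%N, forall i, Q i (s i),
    \sum_(m <= i < m') f i (s i) <= N%:R * r &
    N%:R * t <= \sum_(m <= i < m') g i (s i)].
Proof.
move=> h; elim: N => [|N [m' [s [mm' Qs fs gs]]]].
  exists m.+1, (fun=> pi0); split => //; rewrite mul0r big_nat1 ?f_pi0//.
have [j [m'j Qj fj gj]] := h m'.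
pose s' i := if (i < m')%N then s i else if i == j then pi else pi0.
have mj : (m <= j)%N by rewrite (leq_trans (ltnW mm')).
have s's i : (m <= i < m')%N -> s' i = s i by rewrite /s' => /andP[_ ->].
have s'j : s' j = pi by rewrite /s' ltnNge m'j eqxx.
have s'0 i : (m' <= i < j)%N -> s' i = pi0.
  by rewrite /s' => /andP[m'i ij]; rewrite ltnNge m'i/= ltn_eqF.
have sumE (h' : nat -> Pi -> R) : \sum_(m <= i < j.+1) h' i (s' i) =
    \sum_(m <= i < m') h' i (s i) + \sum_(m' <= i < j) h' i pi0 + h' j pi.
  rewrite big_nat_recr//= s'j (big_cat_nat (ltnW mm') m'j)/=.
  congr (_ + _ + _); apply: eq_big_nat => i ij; first by rewrite s's.
  by rewrite s'0.
exists j.+1, s'; split.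
- by rewrite ltnS.
- by move=> i; rewrite /s'; case: ifP => // _; case: eqP => // ->.
- rewrite sumE [X in _ + X + _]big1 => [|i _]; last exact: f_pi0.
  by rewrite addr0 -natr1 mulrDl mul1r lerD.
- rewrite sumE -natr1 mulrDl mul1r lerD// (le_trans gs)// lerDl.
  exact: sumr_ge0.
Qed.

Lemma condensation :
  (forall k, exists pi r, [/\ 0 < r, r <= 2^-1 ^+ k & forall m, exists i,
     [/\ (m <= i)%N, Q i pi, f i pi <= r & 4 ^+ k * r <= g i pi]]) ->
  exists s : nat -> Pi, [/\ forall i, Q i (s i), bounded_sums (fun i => f i (s i)) &
    ~ bounded_sums (fun i => g i (s i))].
Proof.
move=> h.
have block k m : exists m' (s : nat -> Pi), [/\ (m < m')%N, forall i, Q i (s i),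
    \sum_(m <= i < m') f i (s i) <= 2 * 2^-1 ^+ k &
    1 <= \sum_(m <= i < m') g i (s i)].
  have [pi [r [r0 rk hi]]] := h k.
  pose t : R := 2^-1 ^+ k / r.
  have t1 : 1 <= t by rewrite ler_pdivlMr// mul1r.
  have t0 : 0 <= t by exact: le_trans t1.
  pose N := (Num.truncn t).+1.
  have [Nt tN] : N%:R <= t + 1 /\ t < N%:R.
    have /andP[a b] := truncn_itv t0.
    by rewrite /N -natr1 lerD2r; split => //; rewrite natr1.
  have [m' [s [mm' Qs fs gs]]] := repeat_choice m N hi.
  have tr : t * r = 2^-1 ^+ k by rewrite /t divfK// gt_eqF.
  exists m', s; split => //.
    apply: (le_trans fs); rewrite -tr mulrA ler_pM2r//; lra.
  apply: le_trans gs; rewrite mulrCA.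
  apply: (@le_trans _ _ (4 ^+ k * (t * r))).
    rewrite tr -exprMn (_ : 4 * 2^-1 = 2); last by field.
    by rewrite exprn_ege1// ler1n.
  by rewrite ler_pM2l ?exprn_gt0// ler_pM2r// ltW.
pose R3 k (a b : nat * (nat -> Pi)) := [/\ (a.1 < b.1)%N,
  agree (T := fun=> Pi) a.1 a.2 b.2,
  (forall i, Q i (a.2 i)) -> forall i, Q i (b.2 i) &
  \sum_(a.1 <= i < b.1) f i (b.2 i) <= 2 * 2^-1 ^+ k /\
  1 <= \sum_(a.1 <= i < b.1) g i (b.2 i)].
have step k a : {b | R3 k a b}.
  apply: cid; have [m' [s [mm' Qs fs gs]]] := block k a.1.
  pose s' : nat -> Pi := splice (T := fun=> Pi) a.1 a.2 s.
  have s's i : (a.1 <= i < m')%N -> s' i = s i.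
    by move=> /andP[ai _]; rewrite /s' /splice ltnNge ai.
  exists (m', s'); split => //=.
  - by apply: agree_sym; exact: agree_splice.
  - by move=> Qa i; rewrite /s' /splice; case: ifP.
  - have sumE (h' : nat -> Pi -> R) :
        \sum_(a.1 <= i < m') h' i (s' i) = \sum_(a.1 <= i < m') h' i (s i).
      by apply: eq_big_nat => i /s's ->.
    by rewrite !sumE.
pose u := fix u k := if k is k'.+1 then sval (step k' (u k')) else (0%N, fun=> pi0).
have uS k : R3 k (u k) (u k.+1) by rewrite /=; case: (step k (u k)).
pose M k := (u k).1.
have MS k : (M k < M k.+1)%N by case: (uS k).
have [//||s us] := @agree_limit (fun=> Pi) M (fun k => (u k).2).
  by move=> k; case: (uS k).
have Qu k : forall i, Q i ((u k).2 i).
  by elim: k => [|k ih]; [|case: (uS k) => _ _ + _; apply].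
exists s; split.
- move=> i; rewrite -(us i.+1) => [|]; first exact: Qu.
  exact: (@incr_ge_id M MS i.+1).
- apply/(@bounded_sums_blocks _ _ M) => //.
  apply: (@le_bounded_sums _ _ (fun k => 2 * 2^-1 ^+ k)) => [k|]; last first.
    by apply: bounded_sumsZ => //; exact: bounded_sums_geometric_half.
  have [_ _ _ [le _]] := uS k; apply: le_trans le.
  rewrite le_eqVlt; apply/orP; left; apply/eqP.
  by apply: eq_big_nat => i /andP[_ iM]; rewrite (us k.+1).
- move=> /(@bounded_sums_blocks _ _ M (fun i => g_ge0 _ _) erefl MS)[B hB].
  have : (Num.truncn B).+1%:R <= B.
    apply: le_trans (hB (Num.truncn B).+1).
    rewrite -[X in X%:R]subn0 -sumr_const_nat; apply: ler_sum => k _.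
    have [_ _ _ [_ le]] := uS k; apply: (le_trans le).
    rewrite le_eqVlt; apply/orP; left; apply/eqP.
    by apply: eq_big_nat => i /andP[_ iM]; rewrite (us k.+1).
  by apply/negP; rewrite -ltNge truncnS_gt.
Qed.

Lemma uniform_domination :
  (forall s, (forall i, Q i (s i)) -> bounded_sums (fun i => f i (s i)) ->
     bounded_sums (fun i => g i (s i))) ->
  exists k, forall pi r, 0 < r -> r <= 2^-1 ^+ k ->
    exists m, forall i, (m <= i)%N -> Q i pi -> f i pi <= r -> g i pi < 4 ^+ k * r.
Proof.
move=> h; apply: contrapT => no.
have [|s [Qs fs]] := condensation; last by apply; exact: h.
move=> k; apply: contrapT => nok; apply: no; exists k => pi r r0 rk.
apply: contrapT => nom; apply: nok; exists pi, r; split => // m.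
apply: contrapT => noi; apply: nom; exists m => i mi Qi fi.
by rewrite ltNge; apply/negP => gi; apply: noi; exists i.
Qed.

End condensation.

Lemma dense_enumeration (T : topologicalType) (x0 : T) : separable_space T ->
  exists e : nat -> T, dense (range e).
Proof.
move=> [D cD dD].
have [x Dx] : D !=set0.
  by have [//||x [_ Dx]] := dD setT; [exists x0|exact: openT|exists x].
move/countable_injP : cD => [h injh].
pose e n := xget x0 [set y | D y /\ h y = n].
exists e => O On oO; have [y [Oy Dy]] := dD O On oO; exists y; split => //.
exists (h y) => //; rewrite /e; case: xgetP => [z _ [Dz hz]|/(_ y)]; last by case.
by apply: injh; rewrite ?inE.
Qed.

Lemma asymptotic_Holder (R : realType) (X Y : normedModType R) (p q : R)
    (e : nat -> X) : 1 <= p -> 1 <= q -> separable_space Y ->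
  (forall F : nat -> set X, (forall n, finite_set (F n) /\ F n !=set0) ->
     Borel_reducible (E_fin F p) (E_seq Y q)) ->
  exists (eps C : R) (N : nat -> nat) (T : nat -> X -> nat -> Y),
    [/\ 0 < eps, 0 < C, forall i u n, (N i <= n)%N -> T i u n = 0 &
      forall a b, e a != e b -> `|e a - e b| <= eps ->
        exists m, forall i, (m <= i)%N ->
          C^-1 * `|e a - e b| `^ p <= pdist q 0 (N i) (T i (e a)) (T i (e b))
            <= C * `|e a - e b| `^ p].
Proof.
move=> p1 q1 sY /(_ (fun n => e @` `I_n.+1)) red.
have p0 : p != 0 by rewrite gt_eqF// (lt_le_trans ltr01).
have q0 : q != 0 by rewrite gt_eqF// (lt_le_trans ltr01).
have hF n : finite_set (e @` `I_n.+1) /\ e @` `I_n.+1 !=set0.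
  split; first exact/finite_image/finite_II.
  by exists (e 0%N); exists 0%N.
have [l [N [T [lS TN sep]]]] := separated_reduction p1 q1 sY hF (red hF).
pose f (i : nat) (uv : X * X) : R := `|uv.1 - uv.2| `^ p.
pose g i (uv : X * X) : R := pdist q 0 (N i) (T i uv.1) (T i uv.2).
pose Q i (uv : X * X) :=
  (e @` `I_(l i).+1) uv.1 /\ (e @` `I_(l i).+1) uv.2.
pose pi0 := (e 0%N, e 0%N).
have f0 i pi : 0 <= f i pi by exact: powR_ge0.
have g0 i pi : 0 <= g i pi by exact: pdist_ge0.
have fpi0 i : f i pi0 = 0 by rewrite /f subrr normr0 powR0.
have gpi0 i : g i pi0 = 0.
  by rewrite /g /pdist big1// => n _; rewrite subrr normr0 powR0.
have Qpi0 i : Q i pi0 by split; exists 0%N.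
have sepP s : (forall i, Q i (s i)) -> bounded_sums (fun i => f i (s i)) <->
    bounded_sums (fun i => g i (s i)).
  by move=> Qs; exact: (sep (fun i => (s i).1) (fun i => (s i).2)).
have [k1 h1] := uniform_domination f0 g0 fpi0 Qpi0 (fun s Qs => (sepP s Qs).1).
have [k2 h2] := uniform_domination g0 f0 gpi0 Qpi0 (fun s Qs => (sepP s Qs).2).
pose C : R := Num.max (4 ^+ k1) (4 ^+ k2).
have C0 : 0 < C by rewrite lt_max !exprn_gt0.
exists (2^-1 ^+ k1), C, N, T; split => //.
move=> a b ab abe; set d := `|e a - e b|.
have d0 : 0 < d by rewrite normr_gt0 subr_eq0.
have half1 k : (2^-1 : R) ^+ k <= 1 by rewrite exprn_ile1 ?invf_le1 ?ler1n.
have d1 : d <= 1 by rewrite (le_trans abe).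
have dp0 : 0 < d `^ p by rewrite powR_gt0.
have dpd : d `^ p <= d by rewrite ge1r_powR// d0.
have [m1 hm1] := h1 (e a, e b) (d `^ p) dp0 (le_trans dpd abe).
pose r := d `^ p / 4 ^+ k2.
have r0 : 0 < r by rewrite divr_gt0 ?exprn_gt0.
have rk2 : r <= 2^-1 ^+ k2.
  rewrite /r ler_pdivrMr ?exprn_gt0// -exprMn (_ : 2^-1 * 4 = 2 :> R); last by field.
  by rewrite (le_trans dpd)// (le_trans d1)// exprn_ege1// ler1n.
have [m2 hm2] := h2 (e a, e b) r r0 rk2.
exists (maxn (maxn m1 m2) (maxn a b)) => i.
rewrite !geq_max => /andP[/andP[m1i m2i] /andP[ai bi]].
have il : (i <= l i)%N by exact: incr_ge_id.
have Qi : Q i (e a, e b).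
  by split => /=; [exists a|exists b] => //=; rewrite ltnS (leq_trans _ il).
apply/andP; split.
  rewrite leNgt; apply/negP => lt.
  have := hm2 i m2i Qi; rewrite /r mulrCA mulfV ?gt_eqF ?exprn_gt0// mulr1.
  rewrite /f /= ltxx => /(_ _)/notF; apply.
  apply/ltW/(lt_le_trans lt); rewrite mulrC ler_pM2l// lef_pV2 ?posrE ?exprn_gt0//.
  by rewrite le_max lexx orbT.
apply: (le_trans (ltW (hm1 i m1i Qi (lexx _)))).
by rewrite ler_pM2r// le_max lexx.
Qed.

Section finite_support.
Context {R : realType} {Y : normedModType R} {q : R}.
Hypothesis q0 : 0 < q.

Lemma sum_norm_pow_support (N : nat) (x : nat -> Y) :
  (forall n, (N <= n)%N -> x n = 0) ->
  sum_norm_pow q x = (pdist q 0 N x (fun=> 0))%:E.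
Proof.
move=> xN; rewrite /sum_norm_pow /pdist.
rewrite (nneseries_split 0 N); last by move=> k _; rewrite lee_fin powR_ge0.
rewrite add0n eseries0 ?adde0; last first.
  by move=> i Ni _; rewrite xN// normr0 powR0// gt_eqF.
by rewrite sumEFin; congr EFin; apply: eq_bigr => n _; rewrite subr0.
Qed.

Lemma ell_support (N : nat) (x : nat -> Y) :
  (forall n, (N <= n)%N -> x n = 0) -> x \in ell q.
Proof.
by move=> xN; apply/mem_set; rewrite /ell/= (sum_norm_pow_support xN) ltry.
Qed.

Lemma ell_norm_scaled_support (N : nat) (x y : nat -> Y) (c : R) : 0 <= c ->
  (forall n, (N <= n)%N -> x n = 0) -> (forall n, (N <= n)%N -> y n = 0) ->
  ell_norm q (fun n => c *: x n - c *: y n) = c * pdist q 0 N x y `^ q^-1.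
Proof.
move=> c0 xN yN; rewrite /ell_norm (@sum_norm_pow_support N); last first.
  by move=> n Nn; rewrite xN// yN// subrr.
have -> : pdist q 0 N (fun n => c *: x n - c *: y n) (fun=> 0) =
    c `^ q * pdist q 0 N x y.
  rewrite /pdist mulr_sumr; apply: eq_bigr => n _.
  by rewrite subr0 -scalerBr normrZ ger0_norm// powRM.
by rewrite /= powRM ?powR_ge0 ?pdist_ge0// powRK_inv// gt_eqF.
Qed.

End finite_support.

Lemma reductions_Holder (R : realType) (X Y : normedModType R) (p q : R) :
  1 <= p -> 1 <= q -> separable_space X -> separable_space Y ->
  (forall F : nat -> set X, (forall n, finite_set (F n) /\ F n !=set0) ->
     Borel_reducible (E_fin F p) (E_seq Y q)) ->
  finitely_Holder_embeds (p / q) (@norm_dist R X) (@ell_dist R Y q).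
Proof.
move=> p1 q1 sX sY red.
have p0 : 0 < p by exact: lt_le_trans p1.
have q0 : 0 < q by exact: lt_le_trans q1.
have [e de] := @dense_enumeration X 0 sX.
have [eps [C [N [T [e0 C0 TN asym]]]]] := asymptotic_Holder e p1 q1 sY red.
pose alpha := p / q.
have al0 : 0 < alpha by rewrite divr_gt0.
pose A := C `^ q^-1 * 2 `^ alpha.
have A0 : 0 < A by rewrite mulr_gt0 ?powR_gt0.
exists A => // F /finite_seqP[s Fs].
have FsP x : F x -> x \in s by rewrite Fs.
have Fin (u : F) : \val u \in s by apply: FsP; exact: set_valP.
have [M hM] : exists M, forall i : nat, (M <= i)%N -> forall u, u \in s ->
    forall v, v \in s -> u != v -> (i.+1%:R^-1 : R) <= `|u - v| <= i.+1%:R.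
  apply: (eventually_in_seq (Q := fun u i => forall v, v \in s -> u != v ->
    (i.+1%:R^-1 : R) <= `|u - v| <= i.+1%:R)) => u us.
  apply: (eventually_in_seq (Q := fun v i => u != v ->
    (i.+1%:R^-1 : R) <= `|u - v| <= i.+1%:R)) => v vs.
  have [->|uv] := eqVneq u v; first by exists 0%N.
  have d0 : 0 < `|u - v| by rewrite normr_gt0 subr_eq0.
  pose m := maxn (Num.truncn `|u - v|) (Num.truncn `|u - v|^-1).
  exists m => i; rewrite geq_max => /andP[mi m'i] _.
  have h (x : R) : (Num.truncn x <= i)%N -> x <= i.+1%:R.
    move=> xi; rewrite (le_trans (ltW (truncnS_gt x)))// ler_nat ltnS.
    exact: xi.
  by rewrite h// andbT invf_ple ?posrE ?ltr0n// h.
pose B : R := M.+1%:R.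
have B0 : 0 < B by rewrite ltr0n.
pose lam := eps / (2 * B).
have l0 : 0 < lam by rewrite divr_gt0 ?mulr_gt0.
have approx (x : X) : exists n, `|x - e n| < lam / (4 * B).
  have [||y [xy [n _ ny]]] := de (ball x (lam / (4 * B))).
  - by exists x; apply: ballxx; rewrite divr_gt0// mulr_gt0.
  - exact: ball_open.
  - by exists n; rewrite ny; move: xy; rewrite -ball_normE.
pose g (u : X) := sval (cid (approx (lam *: u))).
have hg u : `|lam *: u - e (g u)| < lam / (4 * B) := svalP (cid (approx (lam *: u))).
have dg u v : u \in s -> v \in s -> u != v ->
    lam * `|u - v| / 2 <= `|e (g u) - e (g v)| <= 2 * (lam * `|u - v|) /\
    `|e (g u) - e (g v)| <= eps.
  move=> us vs uv; have /andP[lo hi] := hM M (leqnn M) u us v vs uv.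
  have low : lam / B <= lam * `|u - v| by rewrite ler_pM2l.
  have high : lam * `|u - v| <= eps / 2.
    have -> : eps / 2 = lam * B by rewrite /lam; field; rewrite gt_eqF.
    by rewrite ler_pM2l.
  have quarter : lam / (4 * B) = (lam / B) / 4 by field; rewrite gt_eqF.
  have nE : `|lam *: u - lam *: v| = lam * `|u - v|.
    by rewrite -scalerBr normrZ gtr0_norm.
  have := hg u; have := hg v; rewrite quarter => gv gu.
  have t1 := ler_distD (e (g u)) (lam *: u) (lam *: v).
  have t2 := ler_distD (e (g v)) (e (g u)) (lam *: v).
  have t3 := ler_distD (lam *: u) (e (g u)) (e (g v)).
  have t4 := ler_distD (lam *: v) (lam *: u) (e (g v)).
  rewrite nE [`|e (g v) - _|]distrC in t1 t2.
  rewrite nE [`|e (g u) - lam *: u|]distrC in t3 t4.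
  have : 0 < lam / B by rewrite divr_gt0.
  move=> lB; clearbody g lam B.
  move: gu gv t1 t2 t3 t4 lB low high.
  move: (lam / B) (lam * `|u - v|) `|e (g u) - e (g v)|.
  move=> lB lt dd *; by split; [apply/andP; split|]; lra.
have [i hi] : exists i, forall u, u \in s -> forall v, v \in s -> u != v ->
    C^-1 * `|e (g u) - e (g v)| `^ p <=
      pdist q 0 (N i) (T i (e (g u))) (T i (e (g v)))
    <= C * `|e (g u) - e (g v)| `^ p.
  suff [m hm] : exists m, forall i : nat, (m <= i)%N -> forall u, u \in s ->
      forall v, v \in s -> u != v -> C^-1 * `|e (g u) - e (g v)| `^ p <=
      pdist q 0 (N i) (T i (e (g u))) (T i (e (g v)))
      <= C * `|e (g u) - e (g v)| `^ p by exists m; exact: hm.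
  apply: (eventually_in_seq (Q := fun u i =>
    forall v, v \in s -> u != v -> _)) => u us.
  apply: (eventually_in_seq (Q := fun v i => u != v -> _)) => v vs.
  have [->|uv] := eqVneq u v; first by exists 0%N.
  have [/andP[lo _] le] := dg u v us vs uv.
  have [|m hm] := asym (g u) (g v) _ le; last by exists m => i mi _; exact: hm.
  rewrite -subr_eq0 -normr_gt0 (lt_le_trans _ lo)// divr_gt0// mulr_gt0//.
  by rewrite normr_gt0 subr_eq0.
pose c := lam `^ (- alpha).
have c0 : 0 <= c by exact: powR_ge0.
have supp (u : X) n : (N i <= n)%N -> c *: T i (e (g u)) n = 0.
  by move=> Nn; rewrite TN// scaler0.
suff bound u v : u \in s -> v \in s -> A^-1 * `|u - v| `^ alpha <=
    c * pdist q 0 (N i) (T i (e (g u))) (T i (e (g v))) `^ q^-1 <=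
    A * `|u - v| `^ alpha.
  exists (fun u : F => SigSub (ell_support q0 (supp (\val u)))) => u v.
  rewrite /ell_dist /= /norm_dist (@ell_norm_scaled_support _ _ _ q0 (N i)
    (T i (e (g (\val u)))) (T i (e (g (\val v)))))//; [|exact: TN..].
  exact: bound (Fin u) (Fin v).
move=> us vs; have [->|uv] := eqVneq u v.
  rewrite subrr normr0 powR0 ?gt_eqF// !mulr0.
  rewrite /pdist big1 ?powR0 ?mulr0 ?lexx ?invr_eq0 ?gt_eqF// => n _.
  by rewrite subrr normr0 powR0// gt_eqF.
have [/andP[dlo dhi] _] := dg u v us vs uv.
have /andP[lo hi'] := hi u us v vs uv.
set D := pdist _ _ _ _ _ in lo hi' *; set d := `|e (g u) - _| in dlo dhi lo hi'.
set t := `|u - v| in dlo dhi *.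
have t0 : 0 <= t by exact: normr_ge0.
have d0 : 0 <= d by exact: normr_ge0.
have D0 : 0 <= D by exact: pdist_ge0.
have qV0 : 0 <= q^-1 by rewrite invr_ge0 ltW.
have root (K y : R) : 0 <= K -> 0 <= y ->
    (K * y `^ p) `^ q^-1 = K `^ q^-1 * y `^ alpha.
  by move=> K0 y0; rewrite powRM ?powR_ge0// -powRrM.
have cl : c * lam `^ alpha = 1 by rewrite /c powRN mulVf// gt_eqF// powR_gt0.
have mono x y : 0 <= x -> x <= y -> x `^ alpha <= y `^ alpha.
  by move=> x0 xy; apply: (ge0_ler_powR (ltW al0)) => //;
     rewrite nnegrE// (le_trans x0).
apply/andP; split.
  have : (C^-1 * d `^ p) `^ q^-1 <= D `^ q^-1.
    apply: (ge0_ler_powR qV0) => //; rewrite nnegrE//.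
    by rewrite mulr_ge0 ?powR_ge0// invr_ge0 ltW.
  rewrite root ?invr_ge0 ?(ltW C0)// => h.
  have := ler_wpM2l c0 h; apply: le_trans.
  have Cq : C^-1 `^ q^-1 = (C `^ q^-1)^-1.
    by rewrite -(powR_inv1 (ltW C0)) powRAC powR_inv1// powR_ge0.
  have dl : lam `^ alpha * t `^ alpha <= 2 `^ alpha * d `^ alpha.
    rewrite -!powRM// ?(ltW l0)//; apply: mono; first by rewrite mulr_ge0 ?(ltW l0).
    lra.
  rewrite Cq /A invfM -!mulrA.
  have Ca0 : 0 < (C `^ q^-1)^-1 by rewrite invr_gt0 powR_gt0.
  rewrite [c * _]mulrCA ler_pM2l// ler_pdivrMl ?powR_gt0//.
  rewrite mulrCA; apply: le_trans (ler_wpM2l c0 dl).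
  by rewrite mulrA cl mul1r.
have : D `^ q^-1 <= (C * d `^ p) `^ q^-1.
  by apply: (ge0_ler_powR qV0) => //; rewrite nnegrE// mulr_ge0 ?powR_ge0// ltW.
rewrite root ?(ltW C0)// => h.
apply: (le_trans (ler_wpM2l c0 h)).
rewrite mulrCA /A -!mulrA ler_wpM2l ?powR_ge0//.
apply: (le_trans (ler_wpM2l c0 (mono _ _ d0 dhi))).
have lt0 : 0 <= lam * t by rewrite mulr_ge0 ?(ltW l0).
rewrite (powRM alpha (ler0n R 2) lt0) (powRM alpha (ltW l0) t0).
rewrite mulrCA ler_wpM2l ?powR_ge0//.
by rewrite mulrA cl mul1r.
Qed.

(** * From Hoelder embeddings to reductions *)

Lemma continuous_Borel_map (S T : topologicalType) (theta : S -> T) :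
  continuous theta -> Borel_map theta.
Proof.
move=> /continuousP ct B /(_ [set B | Borel_set (theta @^-1` B)]).
have [b0 bC bU] := smallest_sigma_algebra setT (@open S).
apply; split; first split.
- by rewrite /= preimage_set0.
- by move=> A bA; rewrite /= setTD preimage_setC -setTD; exact: bC.
- by move=> A bA; rewrite /= preimage_bigcup; exact: bU.
by move=> U oU; apply: sub_sigma_algebra; exact: ct.
Qed.

Lemma nbhs_set_type_finite (X : topologicalType) (F : set X) (x : F) :
  hausdorff_space X -> finite_set F -> nbhs x [set x].
Proof.
move=> hX fF; pose U := ~` (F `\ \val x).
have oU : open U.
  apply: closed_openC.
  apply: (accessible_finite_set_closed.1 (hausdorff_accessible hX)).
  by apply: sub_finite_set fF => y [].
exists [set x]; split => //; exists U => //.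
apply/seteqP; split => [y /= Uy|y /= ->]; last by case=> _; apply.
apply: val_inj; apply: contrapT => yx; apply: Uy; split => //.
exact: set_valP.
Qed.

Lemma nbhs_agree_finite (X : topologicalType) (F : nat -> set X) (m : nat)
    (x : prod_topology (fun n => set_type (F n))) :
  hausdorff_space X -> (forall n, finite_set (F n)) ->
  nbhs x [set y : prod_topology (fun n => set_type (F n)) | agree m x y].
Proof.
move=> hX fF; elim: m => [|m ih]; first by apply: filterS filterT.
have : nbhs x (@proj nat (fun n => set_type (F n)) m @^-1` [set x m]).
  by apply: proj_continuous; exact: nbhs_set_type_finite.
move/(filterI ih); apply: filterS => y [xy ym] i.
by rewrite ltnS leq_eqVlt => /predU1P[->|/xy//]; rewrite -[in LHS]ym.
Qed.

Lemma Holder_reductions (R : realType) (X Y : normedModType R) (p q : R) :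
  1 <= p -> 1 <= q ->
  finitely_Holder_embeds (p / q) (@norm_dist R X) (@ell_dist R Y q) ->
  forall F : nat -> set X, (forall n, finite_set (F n) /\ F n !=set0) ->
     Borel_reducible (E_fin F p) (E_seq Y q).
Proof.
move=> p1 q1 [A A0 emb] F hF.
have p0 : 0 < p by exact: lt_le_trans p1.
have q0 : 0 < q by exact: lt_le_trans q1.
pose T n := sval (cid (emb (F n) (hF n).1)).
have TP n u v := svalP (cid (emb (F n) (hF n).1)) u v.
have /card_set_bijP[b bb] : ([set: nat] #= [set: nat * nat])%card.
  by rewrite card_eq_sym card_nat2.
pose theta (x : prod_topology (fun n => set_type (F n))) :
  prod_topology (fun _ : nat => Y) :=
  fun k => \val (T (b k).1 (x (b k).1)) (b k).2.
exists theta; split.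
  apply: continuous_Borel_map => x V /nbhs_prod_agree[m hm].
  pose M := (\max_(k < m) (b k).1).+1.
  apply: filterS (nbhs_agree_finite M x (@norm_hausdorff _ X)
    (fun n => (hF n).1)) => y xy.
  apply: hm => k km; rewrite /theta xy// ltnS.
  exact: (leq_bigmax (F := fun k : 'I_m => (b k).1) (Ordinal km)).
move=> x y.
pose r n := ell_dist (T n (x n)) (T n (y n)) `^ q.
have sumr n : (\sum_(0 <= m <oo)
    (norm_dist (\val (T n (x n)) m) (\val (T n (y n)) m) `^ q)%:E = (r n)%:E)%E.
  have := @ellB R Y q _ _ q1 (set_valP (T n (x n))) (set_valP (T n (y n))).
  rewrite /r /ell_dist /ell_norm /ell/= /sum_norm_pow => foo.
  rewrite powR_invK ?gt_eqF// ?fineK//.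
    rewrite ge0_fin_numE//; apply: nneseries_ge0 => k _ _.
    by rewrite lee_fin powR_ge0.
  by apply: fine_ge0; apply: nneseries_ge0 => k _ _; rewrite lee_fin powR_ge0.
have -> : E_seq Y q (theta x) (theta y) <-> bounded_sums r.
  rewrite -nneseries_lt_pinftyP; last by move=> n; exact: powR_ge0.
  pose a (nm : nat * nat) := (norm_dist (\val (T nm.1 (x nm.1)) nm.2)
    (\val (T nm.1 (y nm.1)) nm.2) `^ q)%:E.
  have a0 nm : (0 <= a nm)%E by rewrite lee_fin powR_ge0.
  rewrite /E_seq !nneseries_esumT; [|by move=> k; rewrite lee_fin powR_ge0..].
  rewrite [X in (X < _)%E <-> _](_ : _ = (\esum_(k in [set: nat]) a (b k))%E)//.
  rewrite -(reindex_esum [set: nat] [set: nat * nat] b a)//.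
  have -> : [set: nat * nat] = setT `*`` (fun=> setT).
    by apply/seteqP; split.
  rewrite -(esum_esum (a := fun n m => a (n, m)))//.
  rewrite (eq_esum (b := fun n => (r n)%:E))// => n _.
  by rewrite -nneseries_esumT// -sumr.
rewrite /E_fin nneseries_lt_pinftyP; last by move=> n; exact: powR_ge0.
have rP n : (A^-1) `^ q * norm_dist (\val (x n)) (\val (y n)) `^ p <= r n
    <= A `^ q * norm_dist (\val (x n)) (\val (y n)) `^ p.
  have /andP[lo hi] := TP n (x n) (y n).
  set d := norm_dist _ _ in lo hi *.
  have d0 : 0 <= d by exact: normr_ge0.
  have pow K : 0 <= K -> K `^ q * d `^ p = (K * d `^ (p / q)) `^ q.
    by move=> K0; rewrite powRM ?powR_ge0// -powRrM divfK// gt_eqF.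
  have AV0 : 0 <= A^-1 by rewrite invr_ge0 ltW.
  rewrite !pow ?(ltW A0)// /r; apply/andP; split;
    apply: (ge0_ler_powR (ltW q0)) => //; rewrite nnegrE.
  - by rewrite mulr_ge0 ?powR_ge0.
  - exact: powR_ge0.
  - exact: powR_ge0.
  - by rewrite mulr_ge0 ?powR_ge0// ltW.
split => h.
  apply: le_bounded_sums (bounded_sumsZ (powR_ge0 A q) h) => n.
  by case/andP: (rP n).
have AA : (A^-1) `^ q * A `^ q = 1.
  by rewrite -powRM ?invr_ge0 ?ltW// mulVf ?gt_eqF// powR1.
apply: le_bounded_sums (bounded_sumsZ (powR_ge0 A q) h) => n.
have /andP[lo _] := rP n.
have := ler_wpM2l (powR_ge0 A q) lo.
by rewrite mulrA [A `^ q * _]mulrC AA mul1r.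
Qed.

Theorem theorem4p8 (R : realType) (X Y : completeNormedModType R)
    (hX : separable_space X) (hY : separable_space Y)
    (p q : R) (hp : 1 <= p) (hq : 1 <= q) :
  finitely_Holder_embeds (p / q) (@norm_dist R X) (@ell_dist R Y q) <->
  (forall F : nat -> set X,
     (forall n, finite_set (F n) /\ F n !=set0) ->
     Borel_reducible (E_fin F p) (E_seq Y q)).
Proof.
split; first exact: Holder_reductions.
exact: reductions_Holder.
Qed.
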